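(* Let $k\ge 1$, let $(X/Y)$ be a strong dichotomy of $\mathbb{Z}_{2k}$ with polarity $p=T_u\cdot v$, and let $H\subseteq X\times X$ be a fixed subset (harmonic mask), with associated set of three-voice consonances $X_H$. Assume that $\Omega_X(\pi_\alpha(\xi))\neq\varnothing$ for every $\xi\in X_H$ and every $\alpha\in A(\xi)$. Then the assignment $\xi\mapsto S_H(\xi)$ defines a finite directed graph on $X_H$. Equivalently, $$E_H=\{(\xi,\eta)\in X_H\times X_H:\eta\in S_H(\xi)\}$$ is a finite set of directed edges on the vertex set $X_H$.
   Context: **Dichotomies.** $\mathbb{Z}_{2k}$ is the ring of integers mod $2k$. The affine group of $\mathbb{Z}_{2k}$ consists of the maps $T_u\cdot v: z\mapsto u+vz$ with $u\in\mathbb{Z}_{2k}$, $v\in\mathbb{Z}_{2k}^\times$. A dichotomy $(X/Y)$ is a partition of $\mathbb{Z}_{2k}$ with $Y=X^c$ and $|X|=|Y|=k$. It is strong if it is autocomplementary (some affine map sends $X$ onto $Y$) and rigid (only the identity affine map sends $X$ onto $X$). Then there is a unique affine $p=T_u\cdot v$ with $p(X)=Y$, called the polarity. **Two-voice notions.** $\mathbb{Z}_{2k}[\varepsilon]=\{x+\varepsilon.r: x,r\in\mathbb{Z}_{2k}\}$ with $\varepsilon^2=0$ (dual numbers). Put $X[\varepsilon]=\{x+\varepsilon.r: x\in\mathbb{Z}_{2k}, r\in X\}$ and $Y[\varepsilon]=\{x+\varepsilon.r: x\in\mathbb{Z}_{2k}, r\in Y\}$. The affine group $\overrightarrow{GL}(\mathbb{Z}_{2k}[\varepsilon])$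 consists of the maps $T_s\cdot t: z\mapsto s+tz$ with $s\in\mathbb{Z}_{2k}[\varepsilon]$ and $t$ a unit of $\mathbb{Z}_{2k}[\varepsilon]$. For $x\in\mathbb{Z}_{2k}$ put $p_x[\varepsilon]=T_{x(1-v)+\varepsilon.u}\cdot v$. For $\zeta=x+\varepsilon.r\in X[\varepsilon]$ (with cantus-firmus component $x$), $\Omega_X(\zeta)$ is the set of $g\in\overrightarrow{GL}(\mathbb{Z}_{2k}[\varepsilon])$ with $\zeta\in gY[\varepsilon]$ and $p_x[\varepsilon](gX[\varepsilon])=gY[\varepsilon]$. Let $m_X(\zeta)=\max_{g\in\Omega_X(\zeta)}|X[\varepsilon]\cap gX[\varepsilon]|$ and $\Sigma_X(\zeta)=\{g\in\Omega_X(\zeta): |X[\varepsilon]\cap gX[\varepsilon]|=m_X(\zeta)\}$. **Three-voice notions.** $\mathbb{Z}_{2k}[\varepsilon_1,\varepsilon_2]=\{a+\varepsilon_1.b+\varepsilon_2.c: a,b,c\in\mathbb{Z}_{2k}\}$ with $\varepsilon_i\varepsilon_j=0$ for all $i,j\in\{1,2\}$; the element $a+\varepsilon_1.b+\varepsilon_2.c$ is written $\begin{bmatrix} c \\ b \\ a \end{bmatrix}$. Elements of $H\subseteq X\times X$ are written $\begin{bmatrix} c \\ b \end{bmatrix}$ with $b,c\in X$. Put $$X_H=\left\{\begin{bmatrix} c \\ b \\ a \end{bmatrix}: a\in\mathbb{Z}_{2k},\ \begin{bmatrix} c \\ b \end{bmatrix}\in H\right\}.$$ The three pairwise projections to $\mathbb{Z}_{2k}[\varepsilon]$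 are $$\pi_{LM}\begin{bmatrix} c \\ b \\ a \end{bmatrix}=a+\varepsilon.b,\quad \pi_{LU}\begin{bmatrix} c \\ b \\ a \end{bmatrix}=a+\varepsilon.c,\quad \pi_{MU}\begin{bmatrix} c \\ b \\ a \end{bmatrix}=(a+b)+\varepsilon.(c-b).$$ For $\xi\in X_H$, the active pair set is $A(\xi)=\{\alpha\in\{LM,LU,MU\}:\pi_\alpha(\xi)\in X[\varepsilon]\}$. Put $\Sigma(\xi)=\prod_{\alpha\in A(\xi)}\Sigma_X(\pi_\alpha(\xi))$. For $\mathbf g=(g_\alpha)_{\alpha\in A(\xi)}\in\Sigma(\xi)$ put $$C_H(\xi;\mathbf g)=X_H\cap\bigcap_{\alpha\in A(\xi)}\pi_\alpha^{-1}(g_\alpha X[\varepsilon]),\qquad \mu_H(\xi;\mathbf g)=|C_H(\xi;\mathbf g)|.$$ Let $M_H(\xi)=\max_{\mathbf g\in\Sigma(\xi)}\mu_H(\xi;\mathbf g)$, $\Gamma_H(\xi)=\{\mathbf g\in\Sigma(\xi):\mu_H(\xi;\mathbf g)=M_H(\xi)\}$, and define the admitted-successor set $$S_H(\xi)=\bigcup_{\mathbf g\in\Gamma_H(\xi)}C_H(\xi;\mathbf g).$$ *)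

(* Defs.v *)
From HB Require Import structures.
From mathcomp Require Import classical_sets cardinality.
From mathcomp Require Import all_boot all_order all_algebra.

Set Implicit Arguments.
Unset Strict Implicit.
Unset Printing Implicit Defensive.

Import GRing.Theory.
Local Open Scope ring_scope.

(* Square-zero extension R + M: the product of two elements of M is 0. *)
Definition sqzero (R : pzRingType) (M : lmodType R) : Type := (R * M)%type.

Section SqzeroRing.
Variables (R : comUnitRingType) (M : lmodType R).
Local Notation E := (sqzero M).

HB.instance Definition _ := GRing.Zmodule.copy E (R * M)%type.

Implicit Types a b c : E.

Definition sqzero_one : E := (1, 0).
Definition sqzero_mul a b : E := (a.1 * b.1, a.1 *: b.2 + b.1 *: a.2).

Fact sqzero_mulA : associative sqzero_mul.
Proof.
move=> [a m] [b n] [c p]; rewrite /sqzero_mul /=; congr pair; first exact: mulrA.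
by rewrite !scalerDr !scalerA -addrA (mulrC c a) (mulrC c b).
Qed.

Fact sqzero_mulC : commutative sqzero_mul.
Proof. by move=> a b; rewrite /sqzero_mul mulrC addrC. Qed.

Fact sqzero_mul1 : left_id sqzero_one sqzero_mul.
Proof. by move=> [a m]; rewrite /sqzero_mul /= mul1r scale1r scaler0 addr0. Qed.

Fact sqzero_mulDl : left_distributive sqzero_mul +%R.
Proof.
move=> [a m] [b n] [c p]; congr pair => /=; first exact: mulrDl.
by rewrite scalerDl scalerDr addrACA.
Qed.

Fact sqzero_one_neq0 : sqzero_one != 0.
Proof. by apply/eqP => -[/eqP]; rewrite oner_eq0. Qed.

HB.instance Definition _ := GRing.Zmodule_isComNzRing.Build E
  sqzero_mulA sqzero_mulC sqzero_mul1 sqzero_mulDl sqzero_one_neq0.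

Definition sqzero_unit : {pred E} := fun a => a.1 \is a GRing.unit.
Definition sqzero_inv a : E :=
  if a.1 \is a GRing.unit then (a.1^-1, - (a.1^-1 * a.1^-1) *: a.2) else a.

Fact sqzero_mulVx : {in sqzero_unit, left_inverse 1 sqzero_inv *%R}.
Proof.
move=> [a m]; rewrite /in_mem /= /sqzero_unit /= => ua.
rewrite /sqzero_inv /= ua; congr pair; first exact: mulVr.
by rewrite /= !scalerA -scalerDl mulrN mulrA mulrV // mul1r subrr scale0r.
Qed.

Fact sqzero_unitPl a b : b * a = 1 -> sqzero_unit a.
Proof.
by case=> ba _; apply/unitrP; exists b.1; split; rewrite // mulrC.
Qed.

Fact sqzero_inv_out : {in [predC sqzero_unit], sqzero_inv =1 id}.
Proof.
by move=> a; rewrite /in_mem /= /in_mem /= /sqzero_unit /sqzero_inv => /negPf ->.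
Qed.

HB.instance Definition _ := GRing.ComNzRing_hasMulInverse.Build E
  sqzero_mulVx sqzero_unitPl sqzero_inv_out.
End SqzeroRing.

HB.instance Definition _ (R : finComUnitRingType) (M : finLmodType R) :=
  Finite.copy (sqzero M) (R * M)%type.

HB.instance Definition _ (R : finNzRingType) (M N : finLmodType R) :=
  GRing.Lmodule.on (M * N)%type.

Notation dual R := (sqzero (R^o : finLmodType R)).
Notation dual2 R := (sqzero ((R^o * R^o)%type : finLmodType R)).

Section Affine.
Variable R : finComUnitRingType.

(* T_s . t *)
Definition aff (s t : R) : {ffun R -> R} := [ffun z => s + t * z].

Definition affine_group : {set {ffun R -> R}} :=
  [set aff s t | s : R, t : R in GRing.unit].

End Affine.

Section Dichotomy.
Variable R : finComUnitRingType.
Implicit Types (k : nat) (X Y : {set R}) (u v : R).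

Definition dichotomy k X Y := [/\ Y = ~: X, #|X| = k & #|Y| = k].

Definition autocomplementary X Y := exists2 g, g \in affine_group R & g @: X = Y.

Definition rigid X := forall g, g \in affine_group R -> g @: X = X -> g =1 id.

Definition strong_dichotomy k X Y :=
  [/\ dichotomy k X Y, autocomplementary X Y & rigid X].

Definition is_polarity X Y u v := v \is a GRing.unit /\ aff u v @: X = Y.

End Dichotomy.

Section Dual.
Variable R : finComUnitRingType.

(* x + eps.r *)
Definition mkdual (x r : R) : dual R := (x, r).

(* a + eps1.b + eps2.c, i.e. the column [c; b; a]: the lowest voice is first *)
Definition mkdual2 (a b c : R) : dual2 R := (a, (b, c)).

Fact mkdualM x r y s :
  mkdual x r * mkdual y s = mkdual (x * y) (x * s + y * r).
Proof. by []. Qed.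

Fact mkdual2M a b c a' b' c' : mkdual2 a b c * mkdual2 a' b' c' =
  mkdual2 (a * a') (a * b' + a' * b) (a * c' + a' * c).
Proof. by []. Qed.

Fact unit_mkdual x r : (mkdual x r \is a GRing.unit) = (x \is a GRing.unit).
Proof. by []. Qed.

End Dual.

Section TwoVoice.
Variables (R : finComUnitRingType) (X Y : {set R}) (u v : R).

Definition two_voice (Z : {set R}) : {set dual R} :=
  [set mkdual x r | x : R, r : R in Z].

Definition p_eps (x : R) : {ffun dual R -> dual R} :=
  aff (mkdual (x * (1 - v)) u) (mkdual v 0).

Definition Omega (zeta : dual R) : {set {ffun dual R -> dual R}} :=
  [set g in affine_group (dual R) | (zeta \in g @: two_voice Y) &&
     (p_eps zeta.1 @: (g @: two_voice X) == g @: two_voice Y)].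

Definition overlap (g : {ffun dual R -> dual R}) : nat :=
  #|two_voice X :&: g @: two_voice X|.

Definition m_two (zeta : dual R) : nat := (\max_(g in Omega zeta) overlap g)%N.

Definition Sigma_two (zeta : dual R) : {set {ffun dual R -> dual R}} :=
  [set g in Omega zeta | overlap g == m_two zeta].

End TwoVoice.

Variant voice_pair := LM | LU | MU.

Definition voice_pair_code (a : voice_pair) : 'I_3 :=
  match a with LM => inord 0 | LU => inord 1 | MU => inord 2 end.
Definition voice_pair_decode (i : 'I_3) : voice_pair :=
  match val i with 0 => LM | 1 => LU | _ => MU end%N.
Fact voice_pair_codeK : cancel voice_pair_code voice_pair_decode.
Proof. by case; rewrite /voice_pair_decode /= inordK. Qed.
HB.instance Definition _ := Finite.copy voice_pair (can_type voice_pair_codeK).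

Section ThreeVoice.
Variables (R : finComUnitRingType) (X Y : {set R}) (u v : R).
(* (b, c) \in H stands for the column [c; b] *)
Variable H : {set R * R}.

Definition X_H : {set dual2 R} :=
  [set mkdual2 a h.1 h.2 | a : R, h : (R * R)%type in H].

Definition proj (alpha : voice_pair) (xi : dual2 R) : dual R :=
  let: (a, (b, c)) := xi in
  match alpha with
  | LM => mkdual a b
  | LU => mkdual a c
  | MU => mkdual (a + b) (c - b)
  end.

Definition active (xi : dual2 R) : {set voice_pair} :=
  [set alpha | proj alpha xi \in two_voice X].

(* families (g_alpha) indexed by the active pairs of xi *)
Definition family_on (xi : dual2 R) : finType :=
  {ffun {alpha | alpha \in active xi} -> {ffun dual R -> dual R}}.

Definition Sigma_three (xi : dual2 R) : {set family_on xi} :=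
  [set g : family_on xi |
    [forall alpha, g alpha \in Sigma_two X Y u v (proj (val alpha) xi)]].

Definition C_H (xi : dual2 R) (g : family_on xi) : {set dual2 R} :=
  X_H :&: \bigcap_(alpha : {alpha | alpha \in active xi})
            proj (val alpha) @^-1: (g alpha @: two_voice X).

Definition mu_H (xi : dual2 R) (g : family_on xi) : nat := #|C_H g|.

Definition M_H (xi : dual2 R) : nat := (\max_(g in Sigma_three xi) mu_H g)%N.

Definition Gamma_H (xi : dual2 R) : {set family_on xi} :=
  [set g in Sigma_three xi | mu_H g == M_H xi].

Definition S_H (xi : dual2 R) : {set dual2 R} := \bigcup_(g in Gamma_H xi) C_H g.

Definition E_H : set (dual2 R * dual2 R) :=
  [set e | e.1 \in X_H /\ e.2 \in X_H /\ e.2 \in S_H e.1]%classic.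

End ThreeVoice.

Definition finite_digraph (T : Type) (V : set T) (E : set (T * T)) : Prop :=
  [/\ finite_set V, finite_set E & (E `<=` V `*` V)%classic].

(* Main.v *)
Require Import Defs.
From mathcomp Require Import classical_sets cardinality.
From mathcomp Require Import all_boot all_order all_algebra.
Local Open Scope ring_scope.


(** All rings here are finite, so finiteness is automatic. What needs proof is that the two nested
    maximisations are over nonempty sets ([argmax_neq0], [Sigma_three_neq0]) and that successors are
    vertices ([S_H_subset]), since each [C_H] is cut out of [X_H]. *)

Lemma argmax_neq0 {T : finType} {A : {set T}} (F : T -> nat) :
  A != set0 -> [set x in A | F x == \max_(y in A) F y] != set0.
Proof.
rewrite -card_gt0 => /(eq_bigmax_cond F)[x xA maxF].
by apply/set0Pn; exists x; rewrite inE xA maxF /=.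
Qed.

Section AdmittedSuccessors.
Context {R : finComUnitRingType} (X Y : {set R}) (u v : R).
Variable H : {set R * R}.
Implicit Types xi : dual2 R.

(** Maximisers are chosen independently for each active pair; with no active pair, the empty family
    serves. *)
Lemma Sigma_three_neq0 {xi} :
  (forall alpha, alpha \in active X xi -> Omega X Y u v (proj alpha xi) != set0) ->
  Sigma_three X Y u v xi != set0.
Proof.
move=> Omega_neq0.
have /fin_all_exists[g gP] (alpha : {alpha | alpha \in active X xi}) :
    exists g, g \in Sigma_two X Y u v (proj (val alpha) xi).
  by apply/set0Pn/argmax_neq0/Omega_neq0/(valP alpha).
apply/set0Pn; exists [ffun alpha => g alpha]; rewrite inE.
by apply/forallP => alpha; rewrite ffunE; apply: gP.
Qed.

Lemma S_H_subset xi : S_H X Y u v H xi \subset X_H H.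
Proof. by apply/bigcupsP => g _; apply: subsetIl. Qed.

End AdmittedSuccessors.

(* With 0 < k, 2 * k >= 2 and 'Z_(2 * k) is the ring of integers mod 2k.
   The first conjunct says that the maxima in the definition of S_H are
   attained and that S_H xi consists of vertices. *)
Theorem proposition2p5 (k : nat) (k_gt0 : (0 < k)%N)
    (X Y : {set 'Z_(2 * k)}) (u v : 'Z_(2 * k)) (H : {set 'Z_(2 * k) * 'Z_(2 * k)})
    (strongXY : strong_dichotomy k X Y)
    (polXY : is_polarity X Y u v) (HXX : H \subset setX X X)
    (Omega_neq0 : forall xi, xi \in X_H H ->
       forall alpha, alpha \in active X xi -> Omega X Y u v (proj alpha xi) != set0) :
  [/\ forall xi, xi \in X_H H ->
        Gamma_H X Y u v H xi != set0 /\ S_H X Y u v H xi \subset X_H H,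
      finite_digraph [set` X_H H]%classic (E_H X Y u v H) &
      forall xi eta, xi \in X_H H ->
        (E_H X Y u v H (xi, eta) <-> eta \in S_H X Y u v H xi)].
Proof.
split=> [xi xiH | | xi eta xiH].
- split; last exact: S_H_subset.
  (* Second maximisation: [mu_H] over the families in [Sigma_three]. *)
  exact/argmax_neq0/Sigma_three_neq0/Omega_neq0.
- split; try exact: finite_finset.
  by move=> [xi eta] [xiH [etaH _]].
- split=> [[_ [_ //]] | etaS].
  by split=> //; split=> //; apply: (subsetP (S_H_subset X Y u v H xi)) etaS.
Qed.
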